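(* Let $\mathcal{H}=\mathbb{R}^K$ and $\mathcal{G}=\mathbb{R}^N$ with $K\ge N$, let $T\colon\mathcal{G}\to\mathcal{G}$ be linear, let $F^*\colon\mathcal{H}\to\mathcal{G}$ be a frame synthesis operator with frame bounds $\underline{\nu},\overline{\nu}$, let $C$ be a closed convex subset of $\mathcal{H}$ and $C^*=F^*C$, let $(\psi_i)_{1\le i\le N}$ satisfy Assumption (A) of the context (with associated $\mathbb{I}$, $\delta$, $\alpha_i$), let $(\phi_k)_{1\le k\le K}$ be finite functions in $\Gamma_0(\mathbb{R})$, and let $f$, $\Psi$, $g$ and, for $\theta\in\,]0,+\infty[$, $\Psi_\theta$, $g_\theta$ be defined as in the context, with $\epsilon\colon]0,+\infty[\,\to\,]0,+\infty[$ a decreasing function. Suppose that $(TC^* )\cap\operatorname{dom}\Psi\neq\varnothing$. Then: (i) For every $\theta\in\,]0,+\infty[$, $g_\theta\in\Gamma_0(\mathcal{H})$. (ii) For every $(\theta_1,\theta_2)\in\,]0,+\infty[^2$, $\theta_1<\theta_2\Rightarrow g_{\theta_1}\le g_{\theta_2}\le g$. (iii) For every $\theta\in\,]0,+\infty[$, if $TC^*\subset\,]\delta-\epsilon(\theta),+\infty[^N$, then $g_\theta$ has a Lipschitz-continuous gradient over $C$ with constant $\beta_\theta=\theta\|TF^*\|^2\le\theta\,\overline{\nu}\,\|T\|^2$. (iv) For every $\theta\in\,]0,+\infty[$, if $f$ is coercive or if $\operatorname{dom}g_\theta\cap C$ is bounded, then the minimization of $f+g_\theta+\iota_C$ admits a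 solution. In addition, if $f$ is strictly convex on $\operatorname{dom}g_\theta\cap C$, then $f+g_\theta+\iota_C$ has a unique minimizer $\widetilde{x}_\theta$. (v) Assume that (a) $\lim_{\theta\to+\infty}\epsilon(\theta)=0$, (b) $TC^*\subset[\delta,+\infty[^N$, (c) $f$ is coercive or $C$ is bounded, (d) $f$ is strictly convex on $C$. Then there exists $\overline{\theta}\in\,]0,+\infty[$ such that, for every $\theta\in[\overline{\theta},+\infty[$, the minimizer $\widetilde{x}_\theta$ of $f+g_\theta+\iota_C$ is the minimizer of $f+g+\iota_C$.
   Context: $\Gamma_0(\mathcal{X})$ denotes the class of lower semicontinuous convex functions from $\mathcal{X}$ to $]-\infty,+\infty]$ that are proper (not identically $+\infty$). $\operatorname{dom}h=\{x\mid h(x)<+\infty\}$. $\iota_C$ is the indicator function of $C$ ($0$ on $C$, $+\infty$ elsewhere). $h$ is coercive if $\lim_{\|x\|\to+\infty}h(x)=+\infty$. Spaces $\mathbb{R}^K,\mathbb{R}^N$ are Euclidean and operator norms are used. $F^*$ is a frame synthesis operator if it is linear and, $F\colon\mathcal{G}\to\mathcal{H}$ being its adjoint, $\underline{\nu}\,\mathrm{Id}\le F^*\circ F\le\overline{\nu}\,\mathrm{Id}$ for some $(\underline{\nu},\overline{\nu})\in\,]0,+\infty[^2$ (so $F^*$ is surjective). $C^*=F^*C=\{F^*x\mid x\in C\}$. A function has a Lipschitz-continuous gradient over $C$ with constant $\beta$ if there is an open set containing $C$ on which it is differentiable with a $\beta$-Lipschitz continuous gradient. Assumption (A). The functions $\psi_i\colon\mathbb{R}\to\,]-\infty,+\infty]$,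 $1\le i\le N$, are such that there exist a nonempty subset $\mathbb{I}$ of $\{1,\ldots,N\}$ and a constant $\delta\in\mathbb{R}$ such that, for all $i\in\{1,\ldots,N\}$: (1) $\operatorname{dom}\psi_i=\,]\delta,+\infty[$ if $i\in\mathbb{I}$ and $\operatorname{dom}\psi_i=[\delta,+\infty[$ if $i\notin\mathbb{I}$; (2) if $i\in\mathbb{I}$, then $\psi_i$ is twice continuously differentiable on $]\delta,+\infty[$, $\inf_{\upsilon\in]\delta,+\infty[}\psi_i(\upsilon)>-\infty$, $\lim_{\upsilon\to\delta,\,\upsilon>\delta}\psi_i(\upsilon)=+\infty$, and its second-order derivative $\psi_i''$ is decreasing with $\lim_{\upsilon\to+\infty}\psi_i''(\upsilon)=0$; (3) if $i\notin\mathbb{I}$, then there exists $\alpha_i\in[0,+\infty[$ such that $\psi_i(\upsilon)=\alpha_i\upsilon$ for all $\upsilon\in[\delta,+\infty[$. Functions. $f(x)=\sum_{k=1}^K\phi_k(x^{(k)})$ for $x=(x^{(k)})_{1\le k\le K}\in\mathcal{H}$; $\Psi(u)=\sum_{i=1}^N\psi_i(u^{(i)})$ for $u=(u^{(i)})_{1\le i\le N}\in\mathcal{G}$; $g=\Psi\circ T\circ F^*$. Quadratic extension. For $i\in\mathbb{I}$, $\upsilon_i\colon]0,+\infty[\,\to\,]\delta,+\infty[$ is the decreasing function (which exists under Assumption (A), and satisfies $\lim_{\theta\to+\infty}\upsilon_i(\theta)=\delta$) characterized by: for all $\theta\in\,]0,+\infty[$ and $\upsilon\in\,]\delta,+\infty[$,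 $0\le\psi_i''(\upsilon)\le\theta\Leftrightarrow\upsilon\ge\upsilon_i(\theta)$. For $\theta\in\,]0,+\infty[$, $g_\theta=\Psi_\theta\circ T\circ F^*$, where $\Psi_\theta(u)=\sum_{i=1}^N\psi_{\theta,i}(u^{(i)})$ and, for $\upsilon\in\mathbb{R}$, $$\psi_{\theta,i}(\upsilon)=\begin{cases}\frac{\theta}{2}\upsilon^2+\zeta_{i,1}(\theta)\,\upsilon+\zeta_{i,0}(\theta)&\text{if }i\in\mathbb{I}\text{ and }\delta-\epsilon(\theta)\le\upsilon<\upsilon_i(\theta)\\ \alpha_i\upsilon&\text{if }i\notin\mathbb{I}\text{ and }\delta-\epsilon(\theta)\le\upsilon<\delta\\ \psi_i(\upsilon)&\text{otherwise,}\end{cases}$$ with, for $i\in\mathbb{I}$, $\zeta_{i,0}(\theta)=\psi_i(\upsilon_i(\theta))-\upsilon_i(\theta)\psi_i'(\upsilon_i(\theta))+\frac{\theta}{2}(\upsilon_i(\theta))^2$ and $\zeta_{i,1}(\theta)=\psi_i'(\upsilon_i(\theta))-\theta\,\upsilon_i(\theta)$. *)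

(* Defs.v *)
From HB Require Import structures.
From mathcomp Require Import all_boot all_order all_algebra.
From mathcomp Require Import all_classical all_reals all_analysis.
Set Implicit Arguments.
Unset Strict Implicit.
Unset Printing Implicit Defensive.
Import Order.TTheory GRing.Theory Num.Theory.
Import numFieldNormedType.Exports.
Local Open Scope classical_set_scope.
Local Open Scope ring_scope.

(* The library norm on 'rV[R]_n is the sup norm; it is used only through its  *)
(* topology and its bounded sets, which are the Euclidean ones. Everything    *)
(* metric (coercivity, operator norms, Lipschitz constants) uses enorm.       *)
Definition dotp (R : realType) (n : nat) (u v : 'rV[R]_n) : R :=
  \sum_(i < n) u 0 i * v 0 i.

Definition enorm (R : realType) (n : nat) (u : 'rV[R]_n) : R :=
  Num.sqrt (dotp u u).

Definition opnorm (R : realType) (m n : nat) (A : 'rV[R]_m -> 'rV[R]_n) : R :=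
  sup [set enorm (A x) | x in [set x | enorm x <= 1]].

Definition adjoint (R : realType) (m n : nat) (A : 'rV[R]_m -> 'rV[R]_n)
    (B : 'rV[R]_n -> 'rV[R]_m) : Prop :=
  forall x u, dotp (A x) u = dotp x (B u).

Definition frame_synthesis (R : realType) (K N : nat)
    (Fs : {linear 'rV[R]_K -> 'rV[R]_N}) (nu_lo nu_hi : R) : Prop :=
  exists F : {linear 'rV[R]_N -> 'rV[R]_K},
    [/\ adjoint Fs F, 0 < nu_lo, 0 < nu_hi &
        forall u, nu_lo * dotp u u <= dotp (Fs (F u)) u <= nu_hi * dotp u u].

Definition dom (R : realType) (E : Type) (h : E -> \bar R) : set E :=
  [set x | (h x < +oo)%E].

(* Since -oo is excluded, the sum below never has the form +oo - oo. *)
Definition convex_efun (R : realType) (E : lmodType R) (h : E -> \bar R) :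
    Prop :=
  forall (x y : E) (t : R), 0 < t -> t < 1 ->
    (h (t *: x + (1 - t) *: y)%R <= t%:E * h x + (1 - t)%R%:E * h y)%E.

Definition Gamma0 (R : realType) (E : normedModType R) (h : E -> \bar R) :
    Prop :=
  [/\ forall x, h x != -oo%E, dom h !=set0, convex_efun h &
      lower_semicontinuous h].

Definition strictly_convex_on (R : realType) (n : nat) (S : set 'rV[R]_n)
    (F : 'rV[R]_n -> R) : Prop :=
  forall x y (t : R), S x -> S y -> x != y -> 0 < t -> t < 1 ->
    F (t *: x + (1 - t) *: y) < t * F x + (1 - t) * F y.

Definition coercive (R : realType) (n : nat) (h : 'rV[R]_n -> \bar R) : Prop :=
  forall A : R, exists r : R, forall x, r < enorm x -> (A%:E < h x)%E.

Definition indicator (R : realType) (E : Type) (C : set E) (x : E) : \bar R :=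
  if x \in C then 0%E else +oo%E.

Definition minimizer (R : realType) (E : Type) (h : E -> \bar R) (x : E) :
    Prop :=
  forall y, (h x <= h y)%E.

Definition grad (R : realType) (n : nat) (F : 'rV[R]_n -> R) (x : 'rV[R]_n) :
    'rV[R]_n :=
  \row_(k < n) 'D_(delta_mx 0 k) F x.

Definition lipschitz_gradient_over (R : realType) (n : nat)
    (h : 'rV[R]_n -> \bar R) (C : set 'rV[R]_n) (beta : R) : Prop :=
  exists U : set 'rV[R]_n,
    [/\ open U, C `<=` U,
        forall x, U x -> h x \is a fin_num,
        forall x, U x -> differentiable (fine \o h) x &
        forall x y, U x -> U y ->
          enorm (grad (fine \o h) x - grad (fine \o h) y)
            <= beta * enorm (x - y)].

(* Iterated derivatives of the finite part of p, meaningful wherever p is     *)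
(* finite on a neighbourhood.                                                 *)
Definition d1 (R : realType) (p : R -> \bar R) : R -> R := derive1 (fine \o p : R -> R).
Definition d2 (R : realType) (p : R -> \bar R) : R -> R := derive1 (d1 p : R -> R).

Definition C2_on_ray (R : realType) (delta : R) (p : R -> \bar R) : Prop :=
  [/\ forall u, delta < u -> derivable (fine \o p) u 1,
      forall u, delta < u -> derivable (d1 p) u 1 &
      forall u, delta < u -> {for u, continuous (d2 p)}].

(* "Decreasing" is read in the weak sense. *)
Definition decreasing_on_ray (R : realType) (delta : R) (q : R -> R) : Prop :=
  forall u v, delta < u -> u <= v -> q v <= q u.

Record assumptionA (R : realType) (N : nat) (I : {set 'I_N}) (delta : R)
    (alpha : 'I_N -> R) (psi : 'I_N -> R -> \bar R) : Prop := AssumptionA {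
  A_index : exists i, i \in I;
  A_ninfty : forall i u, psi i u != -oo%E;
  A_dom_in : forall i, i \in I -> dom (psi i) = [set u | delta < u];
  A_dom_out : forall i, i \notin I -> dom (psi i) = [set u | delta <= u];
  A_C2 : forall i, i \in I -> C2_on_ray delta (psi i);
  A_inf : forall i, i \in I ->
    (-oo < ereal_inf [set psi i u | u in [set u | (delta < u)%R]])%E;
  A_barrier : forall i, i \in I -> psi i u @[u --> delta^'+] --> +oo%E;
  A_d2_decr : forall i, i \in I -> decreasing_on_ray delta (d2 (psi i));
  A_d2_lim : forall i, i \in I -> d2 (psi i) u @[u --> +oo] --> (0 : R);
  A_alpha : forall i, i \notin I -> 0 <= alpha i;
  A_linear : forall i, i \notin I ->
    forall u, delta <= u -> psi i u = (alpha i * u)%:E }.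

(* The point w of ]delta, +oo[ characterized by                               *)
(*   0 <= p''(u) <= theta <-> u >= w   for all u > delta;                     *)
(* such a w is unique, and the default value is used only if there is none.   *)
Definition upsilon (R : realType) (delta : R) (p : R -> \bar R) (theta : R) :
    R :=
  xget delta [set w | delta < w /\
    forall u, delta < u -> (0 <= d2 p u <= theta <-> w <= u)].

Definition zeta0 (R : realType) (delta : R) (p : R -> \bar R) (theta : R) : R :=
  let w := upsilon delta p theta in
  fine (p w) - w * d1 p w + theta / 2 * w ^+ 2.

Definition zeta1 (R : realType) (delta : R) (p : R -> \bar R) (theta : R) : R :=
  let w := upsilon delta p theta in d1 p w - theta * w.

Definition psi_ext (R : realType) (N : nat) (I : {set 'I_N}) (delta : R)
    (alpha : 'I_N -> R) (eps : R -> R) (psi : 'I_N -> R -> \bar R)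
    (theta : R) (i : 'I_N) (u : R) : \bar R :=
  if [&& i \in I, delta - eps theta <= u & u < upsilon delta (psi i) theta]
  then (theta / 2 * u ^+ 2 + zeta1 delta (psi i) theta * u
        + zeta0 delta (psi i) theta)%:E
  else if [&& i \notin I, delta - eps theta <= u & u < delta]
  then (alpha i * u)%:E
  else psi i u.

Definition separable (R : realType) (N : nat) (p : 'I_N -> R -> \bar R)
    (u : 'rV[R]_N) : \bar R :=
  (\sum_(i < N) p i (u 0%R i))%E.

(* Main.v *)
Require Import Defs.
From HB Require Import structures.
From mathcomp Require Import all_boot all_order all_algebra.
From mathcomp Require Import all_classical all_reals all_analysis.
From mathcomp Require Import ring lra.
Set Implicit Arguments.
Unset Strict Implicit.
Unset Printing Implicit Defensive.
Import Order.TTheory GRing.Theory Num.Theory.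
Import numFieldNormedType.Exports.
Local Open Scope classical_set_scope.
Local Open Scope ring_scope.

(** Each extended barrier, on the half-line [[delta - eps theta, +oo[] where it is
    finite, is the restriction of a function that is defined and differentiable
    on the whole line: the barrier right of the knot [upsilon], and left of it
    the parabola of curvature [theta] that agrees with it to first order.
    The derivative of this function is nondecreasing and [theta]-Lipschitz
    ([quad_ext'_slope]). Therefore [g_theta] equals a finite smooth convex
    function on the closed convex set
    [{x | T Fs x >= delta - eps theta coordinatewise}], and [+oo] outside it
    ([separable_psi_extE]). Membership in [Gamma0], the gradient estimate and the
    existence and uniqueness of minimizers then follow from general facts: such
    a function is in [Gamma0] ([Gamma0_extend]); the gradient of a separable
    function composed with a linear map [L] has Lipschitz constant at most
    [theta |L|^2] ([separable_comp_grad_lipschitz]), where the frame bound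
    controls [|T Fs|] ([opnorm_frame]); and a lower semicontinuous function with
    a bounded sublevel set on a closed set attains its minimum
    ([lsc_min_exists]), only once if it is strictly convex
    ([minimizer_unique]).

    That the knot exists right of [delta] is where the barrier is used: were
    [psi''] bounded by [theta] near [delta], so would be [psi], against
    [psi -> +oo] ([knotP]). Left of the knot [psi'' >= theta], so two applications
    of the mean value theorem put the parabola below [psi] ([parabola_le]), and
    comparing two parabolas with different knots gives the monotonicity in
    [theta] ([quad_ext_mono]).

    For the exactness for large [theta], let [x0] in [C] have finite objective.
    The minimizer [x_theta] of the approximate problem has an approximate
    objective value at most the true objective value at [x0]. On [C] the function [f] and all the
    coordinate terms have lower bounds uniform in [theta >= 1], so every
    coordinate term at [x_theta] is at most a constant [B] independent of
    [theta]. But for large [theta] the barrier exceeds [B] at the knot and has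
    nonpositive slope there, so the parabola exceeds [B] everywhere left of the
    knot ([quad_ext_sublevel]); since the coordinates of [T Fs x_theta] are at
    least [delta], those in [I] lie right of their knots, and
    [g_theta x_theta = g x_theta] ([approx_exact]). A minorant of the objective
    that touches it at the unique minimizer of the minorant has the same unique
    minimizer. *)

(** * Euclidean norm and operator norm *)

Section Euclidean.
Context {R : realType}.

Lemma dotpC n (u v : 'rV[R]_n) : dotp u v = dotp v u.
Proof. by apply: eq_bigr => i _; rewrite mulrC. Qed.

Lemma dotpDl n (u v w : 'rV[R]_n) : dotp (u + v) w = dotp u w + dotp v w.
Proof. by rewrite -big_split; apply: eq_bigr => i _; rewrite mxE mulrDl. Qed.

Lemma dotpZl n a (u v : 'rV[R]_n) : dotp (a *: u) v = a * dotp u v.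
Proof. by rewrite mulr_sumr; apply: eq_bigr => i _; rewrite mxE mulrA. Qed.

Lemma dotp_ge0 n (u : 'rV[R]_n) : 0 <= dotp u u.
Proof. by apply: sumr_ge0 => i _; rewrite -expr2 sqr_ge0. Qed.

Lemma dotp_cauchy n (u v : 'rV[R]_n) : dotp u v ^+ 2 <= dotp u u * dotp v v.
Proof.
(* With a = <u, u>, b = <v, v> and c = <u, v>: for b > 0 the square of b u - c v
   is b (a b - c^2); for b = 0 the square of c u - ((a + 1) / 2) v is - c^2. *)
have expand s t : dotp (s *: u + t *: v) (s *: u + t *: v) =
    s ^+ 2 * dotp u u + 2 * s * t * dotp u v + t ^+ 2 * dotp v v.
  rewrite dotpDl !dotpZl ![dotp _ (_ + _)]dotpC !dotpDl !dotpZl (dotpC v u).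
  by ring.
set c := dotp u v in expand *.
have := dotp_ge0 v; rewrite le_eqVlt => /predU1P[v0|v0].
  rewrite -v0 in expand *.
  have := dotp_ge0 (c *: u + (- (dotp u u + 1) / 2) *: v).
  rewrite expand => h; have := dotp_ge0 u.
  nra.
have := dotp_ge0 (dotp v v *: u + (- c) *: v).
rewrite expand (_ : _ + _ = dotp v v * (dotp u u * dotp v v - c ^+ 2)).
  by rewrite pmulr_rge0 // subr_ge0.
by ring.
Qed.

Lemma enorm_ge0 n (u : 'rV[R]_n) : 0 <= enorm u.
Proof. exact: sqrtr_ge0. Qed.

Lemma enorm_sqr n (u : 'rV[R]_n) : enorm u ^+ 2 = dotp u u.
Proof. by rewrite sqr_sqrtr // dotp_ge0. Qed.

Lemma enormZ n a (u : 'rV[R]_n) : enorm (a *: u) = `|a| * enorm u.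
Proof.
rewrite /enorm dotpZl dotpC dotpZl mulrA -expr2 sqrtrM ?sqr_ge0 //.
by rewrite sqrtr_sqr.
Qed.

Lemma enorm0 n : enorm (0 : 'rV[R]_n) = 0.
Proof. by rewrite -(scale0r (0 : 'rV[R]_n)) enormZ normr0 mul0r. Qed.

Lemma dotp_le_enorm n (u v : 'rV[R]_n) : dotp u v <= enorm u * enorm v.
Proof.
have := dotp_cauchy u v; rewrite -!enorm_sqr -exprMn => h.
apply: le_trans (ler_norm _) _.
by rewrite -ler_sqr ?nnegrE ?mulr_ge0 ?enorm_ge0 // real_normK ?num_real.
Qed.

Lemma sqr_coord_le n (u : 'rV[R]_n) i : u 0 i ^+ 2 <= dotp u u.
Proof.
rewrite /dotp (bigD1 i) //= -expr2 lerDl.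
by apply: sumr_ge0 => j _; rewrite -expr2 sqr_ge0.
Qed.

(** Transfers Euclidean boundedness to the sup norm, in which bounded sets and
    compactness are phrased. *)
Lemma norm_le_enorm n (u : 'rV[R]_n) : `|u| <= enorm u.
Proof.
rewrite [leLHS]/Num.Def.normr/= mx_normrE (bigmax_le _ (enorm_ge0 _)) //=.
move=> -[i j] _ /=; rewrite ord1 -ler_sqr ?nnegrE ?enorm_ge0 //.
by rewrite real_normK ?num_real // enorm_sqr sqr_coord_le.
Qed.

Section LinearMap.
Context {m n : nat} (L : {linear 'rV[R]_m -> 'rV[R]_n}).

Lemma linear_coordE x i : L x 0 i = \sum_(k < m) x 0 k * L (delta_mx 0 k) 0 i.
Proof.
rewrite {1}(row_sum_delta x) linear_sum summxE; apply: eq_bigr => k _.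
by rewrite linearZ mxE.
Qed.

Lemma linear_coord_continuous i : continuous (fun x => L x 0 i).
Proof.
under eq_fun do rewrite linear_coordE.
apply: continuous_big => [|k _ x]; first exact: add_continuous.
apply: (@cvgM _ _ (nbhs x)); [exact: (@coord_continuous _ _ _ 0 k)|exact: cvg_cst].
Qed.

(** Each coordinate of [L x] is the scalar product of [x] with a fixed row, so
    Cauchy-Schwarz applies to it; finiteness of [opnorm L] rests on this. *)
Lemma linear_enorm_bounded : exists2 M, 0 <= M &
  forall x, enorm (L x) <= M * enorm x.
Proof.
pose r i : 'rV[R]_m := \row_k L (delta_mx 0 k) 0 i.
have rE x i : L x 0 i = dotp x (r i).
  by rewrite linear_coordE; apply: eq_bigr => k _; rewrite mxE.
exists (Num.sqrt (\sum_i dotp (r i) (r i))); first exact: sqrtr_ge0.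
move=> x; rewrite -sqrtrM; last by apply: sumr_ge0 => i _; exact: dotp_ge0.
rewrite ler_wsqrtr // mulr_suml; apply: ler_sum => i _.
by rewrite rE -expr2 mulrC dotp_cauchy.
Qed.

Lemma opnorm_le M : 0 <= M -> (forall x, enorm (L x) <= M * enorm x) ->
  opnorm L <= M.
Proof.
move=> M0 hM; apply: ge_sup => [|_ [x /= x1 <-]]; last first.
  by apply: le_trans (hM x) _; rewrite ler_piMr.
by exists (enorm (L 0)); exists 0 => //=; rewrite enorm0 ler01.
Qed.

Lemma enorm_le_opnorm x : enorm (L x) <= opnorm L * enorm x.
Proof.
have [M M0 hM] := linear_enorm_bounded.
have [/eqP x0|x0] := boolP (enorm x == 0).
  by apply: le_trans (hM x) _; rewrite x0 !mulr0.
have {}x0 : 0 < enorm x by rewrite lt_neqAle eq_sym x0 enorm_ge0.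
rewrite -ler_pdivrMr //; apply: ub_le_sup.
  exists M => _ [y /= y1 <-].
  by apply: le_trans (hM y) _; rewrite ler_piMr.
exists ((enorm x)^-1 *: x) => /=.
  by rewrite enormZ ger0_norm ?invr_ge0 ?enorm_ge0 // mulVf // gt_eqF.
by rewrite linearZ enormZ ger0_norm ?invr_ge0 ?enorm_ge0 // mulrC.
Qed.

Lemma opnorm_ge0 : 0 <= opnorm L.
Proof.
have [M M0 hM] := linear_enorm_bounded.
apply: le_trans (enorm_ge0 (L 0)) _; apply: ub_le_sup.
  exists M => _ [y /= y1 <-].
  by apply: le_trans (hM y) _; rewrite ler_piMr.
by exists 0 => //=; rewrite enorm0 ler01.
Qed.

End LinearMap.

(** The upper frame bound says [|F u| <= sqrt hi |u|] for the adjoint [F];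
    the same bound passes to [Fs] through
    [|Fs x|^2 = <x, F (Fs x)> <= |x| sqrt hi |Fs x|]. *)
Lemma enorm_frame K N (Fs : {linear 'rV[R]_K -> 'rV[R]_N}) (lo hi : R) x :
  frame_synthesis Fs lo hi -> enorm (Fs x) <= Num.sqrt hi * enorm x.
Proof.
move=> [F [adj lo0 hi0 bnd]].
have hF u : enorm (F u) <= Num.sqrt hi * enorm u.
  rewrite /enorm -sqrtrM ?(ltW hi0) // ler_wsqrtr // -adj.
  by have /andP[] := bnd u.
have [/eqP x0|x0] := boolP (enorm (Fs x) == 0).
  by rewrite x0 mulr_ge0 ?sqrtr_ge0 ?enorm_ge0.
have {}x0 : 0 < enorm (Fs x) by rewrite lt_neqAle eq_sym x0 enorm_ge0.
rewrite -(ler_pM2r x0) -expr2 enorm_sqr adj.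
apply: le_trans (dotp_le_enorm _ _) _.
by rewrite mulrAC mulrC ler_wpM2r ?enorm_ge0.
Qed.

Lemma opnorm_frame K N (T : {linear 'rV[R]_N -> 'rV[R]_N})
    (Fs : {linear 'rV[R]_K -> 'rV[R]_N}) (lo hi : R) :
  frame_synthesis Fs lo hi ->
  opnorm (T \o Fs) ^+ 2 <= hi * opnorm T ^+ 2.
Proof.
move=> hF; have hi0 : 0 <= hi by case: hF => F [_ _ /ltW].
have h : opnorm (T \o Fs) <= opnorm T * Num.sqrt hi.
  apply: opnorm_le => [|x /=]; first by rewrite mulr_ge0 ?opnorm_ge0 ?sqrtr_ge0.
  apply: le_trans (enorm_le_opnorm T _) _; rewrite -mulrA.
  by rewrite ler_wpM2l ?opnorm_ge0 //; exact: enorm_frame hF.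
rewrite mulrC -(sqr_sqrtr hi0) -exprMn ler_sqr ?nnegrE //.
  exact: (opnorm_ge0 (T \o Fs)).
by rewrite mulr_ge0 ?opnorm_ge0 ?sqrtr_ge0.
Qed.

End Euclidean.

(** * Constrained minimization of lower semicontinuous functions *)

Section Minimization.
Context {R : realType}.

(** The approximations of [g] and their objectives all have this form, with [A]
    closed and [F] finite, so that extended-real arithmetic is only needed to
    recognize it. *)
Definition extend (E : Type) (A : set E) (F : E -> R) (x : E) : \bar R :=
  if x \in A then (F x)%:E else +oo%E.

Definition segment_closed (E : lmodType R) (S : set E) : Prop :=
  forall x y (t : R), S x -> S y -> 0 < t -> t < 1 -> S (t *: x + (1 - t) *: y).

Definition lsc (X : topologicalType) (F : X -> R) : Prop :=
  lower_semicontinuous (fun x => (F x)%:E).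

Lemma lscP (X : topologicalType) (F : X -> R) :
  lsc F <-> forall x a, a < F x -> \forall y \near x, a < F y.
Proof.
split=> [h x a | h x a]; rewrite -?lte_fin => ax.
  by have [V xV VF] := h x a ax; near=> y; rewrite -lte_fin; apply: VF; near: y.
by exists [set y | a < F y] => [|y /=]; [exact: h|rewrite lte_fin].
Unshelve. all: by end_near. Qed.

Lemma continuous_lsc (X : topologicalType) (F : X -> R) :
  continuous F -> lsc F.
Proof.
move=> cF; apply/lscP => x a ax.
exact: (cF x _ (lt_nbhsr ax)).
Qed.

Lemma lscD (X : topologicalType) (F G : X -> R) :
  lsc F -> lsc G -> lsc (F \+ G).
Proof.
move=> /lscP hF /lscP hG; apply/lscP => x a /= ax.
pose e := (F x + G x - a) / 2.
have e0 : 0 < e by rewrite /e; lra.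
near=> y.
have : F x - e < F y by near: y; apply: hF; lra.
have : G x - e < G y by near: y; apply: hG; lra.
rewrite /e; lra.
Unshelve. all: by end_near. Qed.

Lemma lsc_sum (X : topologicalType) (J : Type) (r : seq J) (F : J -> X -> R) :
  (forall j, lsc (F j)) -> lsc (fun x => \sum_(j <- r) F j x).
Proof.
move=> hF; elim: r => [|j r ih].
  by apply: continuous_lsc => x; under eq_fun do rewrite big_nil; exact: cvg_cst.
under eq_fun do rewrite big_cons.
exact: lscD.
Qed.

Lemma lsc_comp (X Y : topologicalType) (h : X -> Y) (F : Y -> R) :
  continuous h -> lsc F -> lsc (F \o h).
Proof. by move=> ch /lscP hF; apply/lscP => x a ax; exact: (ch x _ (hF _ _ ax)). Qed.

Lemma lsc_sublevel_closed (X : topologicalType) (F : X -> R) a :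
  lsc F -> closed [set x | F x <= a].
Proof.
move=> /lscP hF; rewrite (_ : [set x | _] = ~` [set x | a < F x]).
  by apply: open_closedC; rewrite openE => x; exact: hF.
by apply/seteqP; split=> x /=; rewrite leNgt => /negP.
Qed.

(** The sublevel set of [x0] is compact, so the nested family of the nonempty closed
    sublevel sets inside it has a common point. *)
Lemma lsc_min_exists n (A : set 'rV[R]_n) (F : 'rV[R]_n -> R) x0 :
  closed A -> lsc F -> A x0 -> bounded_set (A `&` [set x | F x <= F x0]) ->
  exists2 x, A x & forall y, A y -> F x <= F y.
Proof.
move=> cA lF Ax0; set B := A `&` _ => bB.
have cB : compact B.
  apply: bounded_closed_compact => //; apply: closedI => //.
  exact: lsc_sublevel_closed.
pose S (y : 'rV[R]_n) := B `&` [set x | F x <= F y].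
have FS : ProperFilter (filter_from B S).
  apply: filter_from_proper => [|y By]; last by exists y; split => //=.
  apply: filter_from_filter; first by exists x0; split => //=.
  move=> y z By Bz; have [yz|zy] := leP (F y) (F z).
    by exists y => // x [Bx /= xy]; split; split => //=; exact: le_trans yz.
  by exists z => // x [Bx /= xy]; split; split => //=; exact: le_trans (ltW zy).
have [|p [Bp clp]] := cB _ FS.
  by exists x0; [split => //=|exact: subIsetl].
have [Ap /= px0] := Bp.
exists p => // y Ay; rewrite leNgt; apply/negP => yp.
have By : B y by split => //=; exact: le_trans (ltW yp) px0.
have SF : filter_from B S (S y) by exists y.
have [x [[_ /= xy]]] := clp _ _ SF ((lscP F).1 lF _ _ yp).
by rewrite ltNge xy.
Qed.

Section Extend.
Context {n : nat} {A : set 'rV[R]_n} {F : 'rV[R]_n -> R}.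

Lemma extend_in x : A x -> extend A F x = (F x)%:E.
Proof. by move=> Ax; rewrite /extend mem_set. Qed.

Lemma extend_out x : ~ A x -> extend A F x = +oo%E.
Proof. by move=> Ax; rewrite /extend memNset. Qed.

Lemma dom_extend : dom (extend A F) = A.
Proof.
apply/seteqP; split=> x /=; rewrite /dom /=; last by move=> /extend_in ->; rewrite ltry.
by have [//|/extend_out ->] := pselect (A x); rewrite ltxx.
Qed.

Lemma minimizer_extendP x : A !=set0 ->
  minimizer (extend A F) x <-> A x /\ forall y, A y -> F x <= F y.
Proof.
move=> [x0 Ax0]; split=> [h|[Ax h] y].
  have Ax : A x.
    apply: contrapT => nAx; have := h x0.
    by rewrite extend_out // extend_in // leNgt ltry.
  by split=> // y Ay; have := h y; rewrite !extend_in // lee_fin.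
rewrite extend_in //; have [Ay|nAy] := pselect (A y).
  by rewrite extend_in // lee_fin; exact: h.
by rewrite extend_out // leey.
Qed.

(** The midpoint of two distinct minimizers would have a smaller value. *)
Lemma minimizer_unique x y : segment_closed A ->
  strictly_convex_on A F -> A !=set0 ->
  minimizer (extend A F) x -> minimizer (extend A F) y -> x = y.
Proof.
move=> cA sF A0 /(minimizer_extendP _ A0)[Ax hx] /(minimizer_extendP _ A0)[Ay hy].
apply/eqP; apply: contrapT => /negP xy.
have h2 : 0 < 2^-1 :> R by lra.
have h3 : 2^-1 < 1 :> R by lra.
have := sF x y 2^-1 Ax Ay xy h2 h3.
have := hx _ (cA x y 2^-1 Ax Ay h2 h3); have := hx _ Ay; have := hy _ Ax.
lra.
Qed.

Lemma Gamma0_extend : closed A -> segment_closed A -> A !=set0 -> continuous F ->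
  (forall x y (t : R), 0 < t -> t < 1 ->
    F (t *: x + (1 - t) *: y) <= t * F x + (1 - t) * F y) ->
  Gamma0 (extend A F).
Proof.
move=> clA cA A0 cF cvF; split.
- by move=> x; rewrite /extend; case: ifP.
- by rewrite dom_extend.
- move=> x y t t0 t1.
  have s0 : 0 < 1 - t by rewrite subr_gt0.
  have ninf a z : 0 < a -> (a%:E * extend A F z != -oo)%E.
    move=> a0; have [Az|nAz] := pselect (A z); first by rewrite extend_in.
    by rewrite extend_out // gt0_muley ?lte_fin.
  have [Ax|nAx] := pselect (A x); last first.
    by rewrite [in leRHS](extend_out nAx) gt0_muley ?lte_fin // addye ?leey ?ninf.
  have [Ay|nAy] := pselect (A y); last first.
    by rewrite [in leRHS](extend_out nAy) gt0_muley ?lte_fin // addey ?leey ?ninf.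
  by rewrite !extend_in ?lee_fin ?cvF //; exact: cA.
- move=> x a; have [Ax|nAx] := pselect (A x).
    rewrite extend_in // lte_fin => ax; exists [set y | a < F y].
      by apply: (lscP F).1 _ _ _ ax; exact: continuous_lsc.
    by move=> y /= ay; rewrite /extend; case: ifP; rewrite ?lte_fin ?ltry.
  move=> _; exists (~` A); last by move=> y /extend_out ->; rewrite ltry.
  by apply: open_nbhs_nbhs; split => //; exact: closed_openC.
Qed.

End Extend.
End Minimization.

(** Differentiability only depends on the germ of the function; it is used for
    the finite part of an extended-real function, which agrees with a globally
    smooth function only inside the domain. *)
Lemma near_eq_differentiable (R : numFieldType) (V W : normedModType R)
    (f g : V -> W) (a : V) :
  {near a, f =1 g} -> differentiable f a -> differentiable g a.
Proof.
move=> fg df.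
have key : g \o shift a = cst (g a) + 'd f a +o_ 0 id.
  have := diff_locally df => /eqaddoP hf; apply/eqaddoP => e e0.
  have := hf e e0; rewrite /= ![in X in X -> _]/= -(nbhs_singleton fg).
  have : \forall h \near (0 : V), f (h + a) = g (h + a).
    by have := fg; rewrite (near_shift 0 a) subr0.
  apply: filterS2 => h /= fgh; rewrite !fctE /= fgh.
  by [].
apply/diff_locallyP; rewrite (diff_unique _ key); last exact: diff_continuous.
by split; [exact: diff_continuous|exact: key].
Qed.

(** * Calculus of separable functions composed with a linear map *)

Section SeparableComposition.
Context {R : realType} {m n : nat} (L : {linear 'rV[R]_m -> 'rV[R]_n}).

Lemma is_derive_comp_coord (q : R -> R) (d : R) (x v : 'rV[R]_m) i :
  is_derive (L x 0 i) 1 q d ->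
  differentiable (fun y => q (L y 0 i)) x /\
  'D_v (fun y => q (L y 0 i)) x = d * L v 0 i.
Proof.
move=> dq.
have lin : linear (fun y => L y 0 i : R^o).
  by move=> a y z; rewrite linearP !mxE.
pose lM := GRing.isLinear.Build _ _ _ _ _ lin.
pose l : {linear 'rV[R]_m -> R^o} := HB.pack (fun y => L y 0 i : R^o) lM.
have cl : continuous l by exact: linear_coord_continuous.
have dl : differentiable l x by exact: linear_differentiable.
have dql : differentiable q (l x) by apply/derivable1_diffP; case: dq.
have dcomp : differentiable (q \o l) x by exact: differentiable_comp.
split; first exact: dcomp.
rewrite (deriveE v dcomp) diff_comp // (diff_lin _ cl) /= diff1E //.
by rewrite derive1E (@derive_val _ _ _ _ _ _ _ dq) mulrC.
Qed.

Context {q dq : 'I_n -> R -> R}.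
Hypothesis qdq : forall i (u : R), is_derive u 1 (q i) (dq i u).

Let G x := \sum_i q i (L x 0 i).

Let GE : G = \sum_i (fun x => q i (L x 0 i)).
Proof. by apply/funext => x; rewrite fct_sumE. Qed.

Lemma separable_comp_differentiable x : differentiable G x.
Proof.
rewrite GE; apply: differentiable_sum => i.
by have [] := is_derive_comp_coord 0 (qdq i (L x 0 i)).
Qed.

Lemma separable_comp_derive x v :
  'D_v G x = dotp (\row_i dq i (L x 0 i)) (L v).
Proof.
rewrite GE derive_sum => [|i].
  apply: eq_bigr => i _; rewrite mxE.
  by have [_ ->] := is_derive_comp_coord v (qdq i (L x 0 i)).
apply: diff_derivable.
by have [] := is_derive_comp_coord 0 (qdq i (L x 0 i)).
Qed.

(** The difference [d] of two gradients satisfies [<d, v> = <a, L v>] for all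
    [v], where [a] is the difference of the inner gradients; at [v = d] this
    gives [|d| <= |L| |a|]. *)
Lemma separable_comp_grad_lipschitz theta x y : 0 <= theta ->
  (forall i u v, `|dq i u - dq i v| <= theta * `|u - v|) ->
  enorm (grad G x - grad G y) <= theta * opnorm L ^+ 2 * enorm (x - y).
Proof.
move=> th0 lip.
set a := \row_i dq i (L x 0 i) - \row_i dq i (L y 0 i).
set d := grad G x - grad G y.
have dE v : dotp d v = dotp a (L v).
  rewrite (row_sum_delta v) linear_sum /=.
  rewrite dotpC (big_morph (fun w => dotp w d)
    (fun u w => dotpDl u w d) (_ : _ = 0)); last first.
    by rewrite -(scale0r (0 : 'rV[R]_m)) dotpZl mul0r.
  rewrite dotpC (big_morph (fun w => dotp w a)
    (fun u w => dotpDl u w a) (_ : _ = 0)); last first.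
    by rewrite -(scale0r (0 : 'rV[R]_n)) dotpZl mul0r.
  apply: eq_bigr => k _; rewrite linearZ /= !dotpZl; congr (_ * _).
  rewrite [RHS]dotpC dotpDl -scaleN1r dotpZl -!separable_comp_derive.
  rewrite /dotp (bigD1 k) //= big1 => [|j jk]; rewrite !mxE eqxx /=.
    by rewrite eqxx mul1r addr0 mulN1r.
  by rewrite (negbTE jk) mul0r.
have aL : enorm a <= theta * enorm (L (x - y)).
  rewrite -ler_sqr ?nnegrE ?mulr_ge0 ?enorm_ge0 // exprMn !enorm_sqr.
  rewrite /dotp mulr_sumr; apply: ler_sum => i _.
  rewrite linearB /= !mxE -!expr2 -exprMn -real_normK ?num_real //.
  rewrite -[leRHS]real_normK ?num_real // ler_sqr ?nnegrE //.
  by rewrite normrM (ger0_norm th0).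
have dL : enorm d <= opnorm L * enorm a.
  have [/eqP d0|d0] := boolP (enorm d == 0).
    by rewrite d0 mulr_ge0 ?opnorm_ge0 ?enorm_ge0.
  have {}d0 : 0 < enorm d by rewrite lt_neqAle eq_sym d0 enorm_ge0.
  rewrite -(ler_pM2r d0) -expr2 enorm_sqr dE.
  apply: le_trans (dotp_le_enorm _ _) _.
  by rewrite mulrAC [leRHS]mulrC ler_wpM2l ?enorm_ge0 ?enorm_le_opnorm.
apply: le_trans dL _.
rewrite expr2 mulrCA mulrA -!mulrA ler_wpM2l ?opnorm_ge0 //.
apply: le_trans aL _; rewrite ler_wpM2l //.
exact: enorm_le_opnorm.
Qed.

End SeparableComposition.

Section TangentLine.
Context {R : realType} {q dq : R -> R}.
Hypothesis qdq : forall u : R, is_derive u 1 q (dq u).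
Hypothesis dq_mono : {homo dq : u v / u <= v}.

Lemma tangent_le u v : q u + dq u * (v - u) <= q v.
Proof.
have cq a b : {within `[a, b], continuous q}.
  by apply: derivable_within_continuous => z _; case: (qdq z).
case: (ltgtP u v) => [uv|vu|->]; last by rewrite subrr mulr0 addr0.
  have [c] := MVT uv (fun z _ => qdq z) (cq _ _); rewrite in_itv /= => /andP[uc _] e.
  by rewrite -lerBrDl e ler_wpM2r ?dq_mono ?subr_ge0 // ltW.
have [c] := MVT vu (fun z _ => qdq z) (cq _ _); rewrite in_itv /= => /andP[_ cu] e.
have := dq_mono (ltW cu); nra.
Qed.

(** Average the tangent-line inequality at the combination itself. *)
Lemma convex_of_monotone_derive u v (t : R) : 0 < t -> t < 1 ->
  q (t * u + (1 - t) * v) <= t * q u + (1 - t) * q v.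
Proof.
move=> t0 t1; set w := t * u + _.
have hu : t * (q w + dq w * (u - w)) <= t * q u.
  by rewrite ler_wpM2l ?tangent_le // ltW.
have hv : (1 - t) * (q w + dq w * (v - w)) <= (1 - t) * q v.
  by rewrite ler_wpM2l ?tangent_le // subr_ge0 ltW.
apply: le_trans (lerD hu hv); rewrite le_eqVlt; apply/orP; left; apply/eqP.
by rewrite /w; ring.
Qed.

End TangentLine.

(** * Quadratic extension of one barrier function *)

Section Glue.
Context {R : realType}.

(** Each difference quotient of the glued function at [w] is a difference
    quotient of [f] or of [g]. *)
Lemma is_derive_glue (f g : R -> R) (w d : R) : f w = g w ->
  is_derive w 1 f d -> is_derive w 1 g d ->
  is_derive w 1 (fun u => if u < w then f u else g u) d.
Proof.
move=> fgw [df fd] [dg gd]; set h := fun u => _.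
have hw : h w = g w by rewrite /h ltxx.
have ch : (fun s => s^-1 *: (h (s *: 1 + w) - h w)) @ (0 : R)^' --> d.
  move=> V dV.
  have fV : \forall s \near (0 : R)^', V (s^-1 *: (f (s *: 1 + w) - f w)).
    by apply: df; move: fd; rewrite /derive => ->.
  have gV : \forall s \near (0 : R)^', V (s^-1 *: (g (s *: 1 + w) - g w)).
    by apply: dg; move: gd; rewrite /derive => ->.
  change (\forall s \near (0 : R)^', V (s^-1 *: (h (s *: 1 + w) - h w))).
  near=> s; rewrite hw /h; case: ifP => _; last by near: s.
  by rewrite -fgw; near: s.
apply: DeriveDef; first by apply/cvg_ex; exists d.
exact: cvg_lim ch.
Unshelve. all: by end_near. Qed.

End Glue.

(** What the assumptions say about an index in [I], in terms of real functions:
    [f] is the finite part of [psi i], and [f'], [f''] are its derivatives. *)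
Record barrier_on_ray (R : realType) (delta : R) (f f' f'' : R -> R) : Prop :=
  BarrierOnRay {
  barrier_deriv : forall u : R, delta < u -> is_derive u 1 f (f' u);
  barrier_deriv2 : forall u : R, delta < u -> is_derive u 1 f' (f'' u);
  barrier_cont : forall u : R, delta < u -> {for u, continuous f''};
  barrier_blowup : forall A, \forall u \near delta^'+, A < f u;
  barrier_decr : decreasing_on_ray delta f'';
  barrier_lim : f'' u @[u --> +oo] --> (0 : R);
  barrier_bounded : exists m, forall u, delta < u -> m <= f u }.

Section Barrier.
Context {R : realType} (delta : R) (f f' f'' : R -> R).
Hypothesis hf : barrier_on_ray delta f f' f''.

Let f_deriv := barrier_deriv hf.
Let f'_deriv := barrier_deriv2 hf.
Let f''_cont := barrier_cont hf.
Let f_barrier := barrier_blowup hf.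
Let f''_decr := barrier_decr hf.
Let f''_lim := barrier_lim hf.

Lemma ray_MVT (h dh : R -> R) (u v : R) : delta < u -> u <= v ->
  (forall w : R, delta < w -> is_derive w 1 h (dh w)) ->
  exists c, [/\ u <= c, c <= v & h v - h u = dh c * (v - u)].
Proof.
move=> du uv hd.
have [||c] := @MVT_segment R h dh u v uv.
- by move=> x; rewrite in_itv /= => /andP[/(lt_trans du)/hd].
- apply: derivable_within_continuous => x; rewrite in_itv /= => /andP[ux _].
  by case: (hd x (lt_le_trans du ux)).
- by rewrite in_itv /= => /andP[uc cv] e; exists c.
Qed.

(** A negative value would persist to the right by monotonicity, against the
    limit [0]. *)
Lemma f''_ge0 u : delta < u -> 0 <= f'' u.
Proof.
move=> du; rewrite leNgt; apply/negP => f2u.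
have h : \forall v \near +oo, f'' u < f'' v by exact: (f''_lim (lt_nbhsr f2u)).
have [v [/= hv uv]] := filter_ex (filterI h (nbhs_pinfty_ge (num_real u))).
by move: hv; rewrite ltNge f''_decr.
Qed.

Lemma f'_mono u v : delta < u -> u <= v -> f' u <= f' v.
Proof.
move=> du uv; have [c [uc _ e]] := ray_MVT du uv f'_deriv.
by rewrite -subr_ge0 e mulr_ge0 ?subr_ge0 // f''_ge0 // (lt_le_trans du uc).
Qed.

Lemma barrier_above A c : delta < c ->
  exists u, [/\ delta < u, u < c & A < f u].
Proof.
move=> dc.
near delta^'+ => u; exists u.
by split; near: u; [exact: nbhs_right_gt|exact: nbhs_right_lt|exact: f_barrier].
Unshelve. all: by end_near. Qed.

(** By the mean value theorem [f] has negative slope somewhere right of a point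
    where it exceeds [f (delta + 1)], hence, by monotonicity of [f'], everywhere
    left of that point, and there [f] only grows towards [delta]. *)
Lemma barrier_descent B : exists2 u0, delta < u0 &
  forall u, delta < u -> u <= u0 -> f' u <= 0 /\ B < f u.
Proof.
have dc : delta < delta + 1 by rewrite ltrDl.
have [u0 [du0 u0c]] := barrier_above (Num.max B (f (delta + 1))) dc.
rewrite gt_max => /andP[Bu0 fu0].
have [c [uc cc e]] := ray_MVT du0 (ltW u0c) f_deriv.
have d1u0 : f' u0 <= 0.
  apply: le_trans (f'_mono du0 uc) _; rewrite leNgt; apply/negP => c0.
  have : 0 < f' c * (delta + 1 - u0) by rewrite mulr_gt0 // subr_gt0.
  rewrite -e; lra.
exists u0 => // u du uu0; split; first exact: le_trans (f'_mono du uu0) _.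
have [b [ub bu0 eb]] := ray_MVT du uu0 f_deriv.
have d1b : f' b <= 0 by apply: le_trans (f'_mono (lt_le_trans du ub) bu0) _.
have : f' b * (u0 - u) <= 0 by rewrite mulr_le0_ge0 // subr_ge0.
by rewrite -eb; lra.
Qed.

(** The point at which the quadratic extension is attached; [upsilon delta p] is
    [knot] for the second derivative of [p]. *)
Definition knot theta : R :=
  xget delta [set w | delta < w /\
    forall u, delta < u -> (0 <= f'' u <= theta <-> w <= u)].

Section Curvature.
Context (theta : R).
Hypothesis theta0 : 0 < theta.

Local Notation w := (knot theta).

(** If [f''] were at most [theta] on the whole ray then [f'], hence [f], would be
    bounded near [delta], against the barrier; so the infimum of the
    sublevel set of [f''] lies strictly right of [delta]. *)
Lemma knotP : delta < w /\
  forall u, delta < u -> (0 <= f'' u <= theta <-> w <= u).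
Proof.
suff [v hv] : exists v, delta < v /\
    forall u, delta < u -> (0 <= f'' u <= theta <-> v <= u).
  by rewrite /knot; case: xgetP => [? _ []//|/(_ v)]; case.
pose S := [set u | delta < u /\ f'' u <= theta].
have [s [ds sS]] : S !=set0.
  have h : \forall v \near +oo, f'' v < theta by exact: (f''_lim (lt_nbhsl theta0)).
  have [v [/= hv dv]] := filter_ex (filterI h (nbhs_pinfty_gt (num_real delta))).
  by exists v; split => //; exact: ltW.
have lbS : lbound S delta by move=> u [/ltW].
have up u v : S u -> u <= v -> S v.
  move=> [du su] uv; split; first exact: lt_le_trans uv.
  by apply: le_trans su; exact: f''_decr.
have hiS : has_inf S by split; [exists s|exists delta].
have infS v : inf S < v -> S v.
  rewrite -subr_gt0 => /inf_adherent /(_ hiS) [e Se].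
  by rewrite addrC subrK => /ltW; exact: up.
have dinf : delta < inf S.
  rewrite lt_neqAle lb_le_inf ?andbT //; last by exists s.
  apply/negP => /eqP einf.
  have all v : delta < v -> f'' v <= theta by rewrite einf => /infS[].
  have [c [dc c1]] : exists c, delta < c /\ c - delta <= 1.
    by exists (delta + 1); split; [rewrite ltrDl|rewrite addrAC subrr add0r].
  have [u [du uc fu]] := barrier_above (f c + `|f' c| + theta) dc.
  have [b [ub bc eb]] := ray_MVT du (ltW uc) f_deriv.
  have db := lt_le_trans du ub.
  have [a [ba ac ea]] := ray_MVT db bc f'_deriv.
  have ha : f'' a * (c - b) <= theta.
    have cb0 : 0 <= c - b by rewrite subr_ge0.
    have cb1 : c - b <= 1 by lra.
    have := ler_wpM2r cb0 (all a (lt_le_trans db ba)).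
    have := ler_wpM2l (ltW theta0) cb1; lra.
  have uc1 : c - u <= 1 by lra.
  have := ler_norm (- f' c); rewrite normrN => hc.
  have : - (`|f' c| + theta) <= f' b * (c - u).
    set k := `|f' c| + theta.
    have kb : - k <= f' b by rewrite /k; lra.
    have k0 : 0 <= k by rewrite addr_ge0 // ltW.
    have cu0 : 0 <= c - u by rewrite subr_ge0 ltW.
    have := mulr_ge0 k0 (_ : 0 <= 1 - (c - u)).
    have := mulr_ge0 (_ : 0 <= f' b + k) cu0.
    rewrite !subr_ge0 -lerBlDr sub0r => /(_ kb) ? /(_ uc1) ?; lra.
  by rewrite -eb; lra.
exists (inf S); split => // u du; split.
  by move=> /andP[_ su]; apply: ge_inf => //; exists delta.
move=> iu; rewrite f''_ge0 //=; move: iu; rewrite le_eqVlt => /predU1P[iu|/infS[]//].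
rewrite leNgt; apply/negP => su.
have cu : \forall v \near u, theta < f'' v.
  exact: (f''_cont du (lt_nbhsr su)).
have [v [tv uv]] : exists v, theta < f'' v /\ u < v.
  near u^'+ => v; exists v; split; last by near: v; exact: nbhs_right_gt.
  by near: v; exact: cvg_within cu.
by have [] := infS v; rewrite ?iu // => _; rewrite leNgt tv.
Unshelve. all: by end_near. Qed.

Lemma knot_gt : delta < w. Proof. by case: knotP. Qed.

Lemma f''_gt_theta u : delta < u -> u < w -> theta <= f'' u.
Proof.
move=> du uw; rewrite leNgt; apply/negP => h.
have [_ /(_ u du) [/(_ _)]] := knotP.
by rewrite f''_ge0 // (ltW h) => /(_ isT); rewrite leNgt uw.
Qed.

Lemma f''_le_theta u : w <= u -> f'' u <= theta.
Proof.
move=> wu; have [dw /(_ u (lt_le_trans dw wu)) [_ /(_ wu)]] := knotP.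
by case/andP.
Qed.

Lemma f'_le_tangent u : delta < u -> u <= w -> f' u <= f' w + theta * (u - w).
Proof.
move=> du; rewrite le_eqVlt => /predU1P[->|uw]; first by rewrite subrr mulr0 addr0.
have cont : {within `[u, w], continuous (f')}.
  apply: derivable_within_continuous => x; rewrite in_itv /= => /andP[ux _].
  by case: (f'_deriv (lt_le_trans du ux)).
have hd (x : R) : x \in `]u, w[ -> is_derive x 1 f' (f'' x).
  by rewrite in_itv /= => /andP[/(lt_trans du) /f'_deriv].
have [c] := MVT uw hd cont.
rewrite in_itv /= => /andP[uc cw] e.
have := f''_gt_theta (lt_trans du uc) cw; nra.
Qed.

(** The quadratic branch of the extension, written around the knot: it is the
    second-order Taylor polynomial with curvature [theta]. *)
Definition parabola u : R := f w + f' w * (u - w) + theta / 2 * (u - w) ^+ 2.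

Lemma is_derive_parabola (u : R) :
  is_derive u 1 parabola (f' w + theta * (u - w)).
Proof.
rewrite /parabola; apply: is_derive_eq.
by rewrite /GRing.scale /=; field.
Qed.

(** The gap [f - parabola] vanishes at [w] and has nonpositive slope on its left. *)
Lemma parabola_le u : delta < u -> u <= w -> parabola u <= f u.
Proof.
move=> du uw.
have hd (v : R) : delta < v ->
    is_derive v 1 (f - parabola) (f' v - (f' w + theta * (v - w))).
  by move=> /f_deriv ?; apply: is_deriveB; exact: is_derive_parabola.
have [c [uc cw]] := ray_MVT du uw hd.
have := f'_le_tangent (lt_le_trans du uc) cw.
have pw : parabola w = f w by rewrite /parabola subrr; ring.
rewrite !fctE /= pw; nra.
Qed.

(** The extension is continued by its quadratic branch on the whole line, so that
    it is differentiable everywhere; the truncation at [delta - eps theta] is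
    handled separately, as a domain constraint. *)
Definition quad_ext u : R := if u < w then parabola u else f u.

Definition quad_ext' u : R :=
  if u < w then f' w + theta * (u - w) else f' u.

Lemma is_derive_quad_ext (u : R) : is_derive u 1 quad_ext (quad_ext' u).
Proof.
rewrite /quad_ext'; case: (ltgtP u w) => uw.
- apply: near_eq_is_derive (is_derive_parabola u).
  by near=> v; rewrite /quad_ext ifT //; near: v; exact: lt_nbhsl.
- apply: near_eq_is_derive (f_deriv (lt_trans knot_gt uw)).
  near=> v; rewrite /quad_ext ifF //; apply/negbTE; rewrite -leNgt ltW //.
  by near: v; exact: lt_nbhsr.
- rewrite uw; apply: is_derive_glue; last exact: f_deriv knot_gt.
    by rewrite /parabola subrr; ring.
  by apply: is_derive_eq (is_derive_parabola w) _; rewrite subrr mulr0 addr0.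
Unshelve. all: by end_near. Qed.

(** The second derivative is [theta] left of the knot and lies in [[0, theta]]
    right of it; this one estimate contains both convexity and the Lipschitz
    bound on the derivative. *)
Lemma quad_ext'_slope u v : u <= v ->
  0 <= quad_ext' v - quad_ext' u <= theta * (v - u).
Proof.
have ray a b : w <= a -> a <= b ->
    0 <= f' b - f' a <= theta * (b - a).
  move=> wa ab; have da := lt_le_trans knot_gt wa.
  have [c [ac cb ->]] := ray_MVT da ab f'_deriv.
  have ba0 : 0 <= b - a by rewrite subr_ge0.
  rewrite mulr_ge0 ?f''_ge0 ?(lt_le_trans da ac) //.
  by rewrite ler_wpM2r ?f''_le_theta ?(le_trans wa ac).
rewrite /quad_ext' => uv; case: (ltP u w) (ltP v w) => [uw|wu] [vw|wv].
- rewrite (_ : _ - _ = theta * (v - u)); last by ring.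
  by rewrite lexx andbT mulr_ge0 ?subr_ge0 // ltW.
- have /andP[lo hi] := ray w v (lexx _) wv.
  have hw : 0 <= theta * (w - u) by rewrite mulr_ge0 ?subr_ge0 // ltW.
  by apply/andP; split; lra.
- by have := le_lt_trans (le_trans wu uv) vw; rewrite ltxx.
- exact: ray.
Qed.

(** Completing the square bounds the parabola, and [f] is bounded by assumption. *)
Lemma quad_ext_bounded : exists m, forall u, m <= quad_ext u.
Proof.
have [m hm] := barrier_bounded hf.
exists (Num.min m (f w - (f' w) ^+ 2 / (2 * theta))) => u.
rewrite /quad_ext; case: ltP => uw; rewrite ge_min; apply/orP; [right|left].
  have -> : parabola u =
      f w - f' w ^+ 2 / (2 * theta) + (theta * (u - w) + f' w) ^+ 2 / (2 * theta).
    by rewrite /parabola; field; rewrite gt_eqF.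
  by rewrite lerDl divr_ge0 ?sqr_ge0 // mulr_ge0 // ltW.
exact/hm/(lt_le_trans knot_gt).
Qed.

Lemma quad_ext_le u : delta < u -> quad_ext u <= f u.
Proof.
by move=> du; rewrite /quad_ext; case: ltP => // uw; apply: parabola_le => //; exact: ltW.
Qed.

End Curvature.

Lemma knot_le theta u : 0 < theta -> delta < u -> f'' u <= theta ->
  knot theta <= u.
Proof.
move=> t0 du h; have [_ /(_ u du) [+ _]] := knotP t0.
by apply; rewrite f''_ge0.
Qed.

(** A larger [theta] moves the knot [b] left of the old knot [a]. Between the knots
    the new extension is [f], which lies above the old parabola; left of [b] the
    new parabola starts at [b] with a larger value, a smaller slope and a
    larger curvature than the old one. *)
Lemma quad_ext_mono s t u : 0 < s -> s <= t ->
  quad_ext s u <= quad_ext t u.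
Proof.
move=> s0 st; have t0 := lt_le_trans s0 st.
have dws := knot_gt s0; have dwt := knot_gt t0.
have wts : knot t <= knot s.
  by apply: knot_le => //; apply: le_trans (f''_le_theta s0 (lexx _)) st.
rewrite /quad_ext; case: (ltP u (knot t)) => ut; last first.
  by case: ltP => us //; apply: parabola_le => //; [exact: lt_le_trans ut|exact: ltW].
rewrite (lt_le_trans ut wts).
have := parabola_le s0 dwt wts; have := f'_le_tangent s0 dwt wts.
rewrite /parabola.
set a := knot s; set b := knot t in ut *.
move=> h1 h2.
rewrite -subr_ge0.
have -> : f b + f' b * (u - b) + t / 2 * (u - b) ^+ 2 -
    (f a + f' a * (u - a) + s / 2 * (u - a) ^+ 2) =
    (f b - (f a + f' a * (b - a) + s / 2 * (b - a) ^+ 2)) +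
    (f' a + s * (b - a) - f' b) * (b - u) + (t - s) / 2 * (u - b) ^+ 2.
  by field.
apply: addr_ge0; first apply: addr_ge0.
- by rewrite subr_ge0.
- by rewrite mulr_ge0 ?subr_ge0 // ltW.
- by rewrite mulr_ge0 ?sqr_ge0 // divr_ge0 ?subr_ge0.
Qed.

(** Once [theta] is large the parabola sits at a knot where [f] already exceeds
    [B] with nonpositive slope, so to the left of the knot it exceeds [B] too. *)
Lemma quad_ext_sublevel B : exists2 t0, 0 < t0 & forall theta u, t0 <= theta ->
  quad_ext theta u <= B -> knot theta <= u.
Proof.
have [u0 du0 hu0] := barrier_descent B.
exists (Num.max 1 (f'' u0)) => [|theta u]; first by rewrite lt_max ltr01.
rewrite ge_max => /andP[t1 tu0]; have t0 := lt_le_trans ltr01 t1.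
rewrite /quad_ext; case: ltP => // uw qB.
have [d1w Bw] := hu0 _ (knot_gt t0) (knot_le t0 du0 tu0).
exfalso; move: qB; apply/negP; rewrite -ltNge /parabola; apply: lt_le_trans Bw _.
rewrite -addrA lerDl addr_ge0 //.
  by rewrite mulr_le0 // subr_le0 ltW.
by rewrite mulr_ge0 ?sqr_ge0 // divr_ge0 // ltW.
Qed.

End Barrier.

(** * The family of coordinate functions *)

Section SmoothPieces.
Context {R : realType} {N : nat} (I : {set 'I_N}) (delta : R).
Context (alpha : 'I_N -> R) (psi : 'I_N -> R -> \bar R).
Hypothesis hA : assumptionA I delta alpha psi.

Lemma psi_fin i u : i \in I -> delta < u -> psi i u \is a fin_num.
Proof.
move=> iI du; rewrite fin_numE (A_ninfty hA) /= -ltey.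
by have : dom (psi i) u by rewrite (A_dom_in hA iI).
Qed.

Lemma psi_left i u : u < delta -> psi i u = +oo%E.
Proof.
move=> ud; apply/eqP; rewrite -leye_eq leNgt; apply/negP => psiu.
have : dom (psi i) u by [].
have [iI|iI] := boolP (i \in I).
  by rewrite (A_dom_in hA iI) /= ltNge ltW.
by rewrite (A_dom_out hA iI) /= leNgt ud.
Qed.

Lemma psi_edge i : i \in I -> psi i delta = +oo%E.
Proof.
move=> iI; apply/eqP; rewrite -leye_eq leNgt; apply/negP => psiu.
by have : dom (psi i) delta by []; rewrite (A_dom_in hA iI) /= ltxx.
Qed.

Lemma psi_barrier i : i \in I ->
  barrier_on_ray delta (fine \o psi i) (d1 (psi i)) (d2 (psi i)).
Proof.
move=> iI; have [der der2 cont] := A_C2 hA iI; split.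
- move=> u du; apply: DeriveDef; first exact: der.
  by rewrite /d1 (derive1E (fine \o psi i)).
- move=> u du; apply: DeriveDef; first exact: der2.
  by rewrite /d2 (derive1E (d1 (psi i))).
- exact: cont.
- move=> A; have /cvgeyPgt /(_ A) h := A_barrier hA iI.
  near=> u; have du : delta < u by near: u; exact: nbhs_right_gt.
  by rewrite /= -lte_fin fineK ?psi_fin //; near: u.
- exact: A_d2_decr hA i iI.
- exact: A_d2_lim hA i iI.
- have := A_inf hA iI; set J := ereal_inf _ => J_gt.
  have le_J u : delta < u -> (J <= psi i u)%E.
    by move=> du; apply: ereal_inf_lbound; exists u.
  exists (fine J) => u du; rewrite /= fine_le ?psi_fin ?le_J //.
  rewrite fin_numE gt_eqF //= lt_eqF //.
  by apply: le_lt_trans (le_J u du) _; rewrite ltey_eq psi_fin.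
Unshelve. all: by end_near. Qed.

(** An everywhere differentiable function that agrees with [psi_ext] on
    [[delta - eps theta, +oo[]; outside [I] it is the full linear function. *)
Definition smooth theta i u : R :=
  if i \in I
  then quad_ext delta (fine \o psi i) (d1 (psi i)) (d2 (psi i)) theta u
  else alpha i * u.

Definition smooth' theta i u : R :=
  if i \in I then quad_ext' delta (d1 (psi i)) (d2 (psi i)) theta u
  else alpha i.

Lemma smooth_le_psi theta i u : 0 < theta ->
  ((smooth theta i u)%:E <= psi i u)%E.
Proof.
move=> t0; rewrite /smooth; case: ifPn => iI.
  case: (ltgtP u delta) => [ud|du|->].
  - by rewrite psi_left // leey.
  - rewrite -(fineK (psi_fin iI du)) lee_fin.
    exact: (quad_ext_le (psi_barrier iI) t0 du).
  - by rewrite psi_edge // leey.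
have [ud|du] := ltP u delta; first by rewrite psi_left // leey.
by rewrite (A_linear hA).
Qed.

Lemma smooth_mono s t i u : 0 < s -> s <= t -> smooth s i u <= smooth t i u.
Proof.
move=> s0 st; rewrite /smooth; case: ifPn => // iI.
exact: (quad_ext_mono (psi_barrier iI) u s0 st).
Qed.

Lemma smooth_eq_psi theta i u : 0 < theta -> delta <= u ->
  (i \in I -> upsilon delta (psi i) theta <= u) ->
  psi i u = (smooth theta i u)%:E.
Proof.
move=> t0 du hu; rewrite /smooth; case: ifPn => iI; last exact: A_linear hA _ _ _ du.
have wu := hu iI; rewrite /quad_ext ifF; last by apply/negbTE; rewrite -leNgt.
by rewrite fineK // psi_fin // (lt_le_trans (knot_gt (psi_barrier iI) t0)).
Qed.

Lemma smooth_sublevel B : exists2 t0, 0 < t0 & forall theta i u, t0 <= theta ->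
  i \in I -> smooth theta i u <= B -> upsilon delta (psi i) theta <= u.
Proof.
have ht i : exists t, i \in I -> 0 < t /\ forall theta u, t <= theta ->
    smooth theta i u <= B -> upsilon delta (psi i) theta <= u.
  have [iI|iI] := boolP (i \in I); last by exists 0.
  have [t t0 ht] := quad_ext_sublevel (psi_barrier iI) B.
  by exists t => _; split=> // theta u; rewrite /smooth iI; exact: ht.
have [t {}ht] := choice ht.
(* This dominates the thresholds of all indices at once. *)
exists (1 + \sum_i `|t i|) => [|theta i u tt iI].
  by rewrite ltr_pwDl // sumr_ge0.
have [_] := ht i iI; apply; apply: le_trans tt.
rewrite (bigD1 i) //=.
have : 0 <= \sum_(j | j != i) `|t j| by rewrite sumr_ge0.
have := ler_norm (t i); lra.
Qed.

Section FixedTheta.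
Context (theta : R).
Hypothesis theta0 : 0 < theta.

Lemma is_derive_smooth i (u : R) :
  is_derive u 1 (smooth theta i) (smooth' theta i u).
Proof.
rewrite /smooth /smooth'; case: ifPn => iI.
  exact: (is_derive_quad_ext (psi_barrier iI) theta0 u).
apply: is_derive_eq.
by rewrite /GRing.scale /=; ring.
Qed.

Lemma smooth'_slope i u v : u <= v ->
  0 <= smooth' theta i v - smooth' theta i u <= theta * (v - u).
Proof.
move=> uv; rewrite /smooth'; case: ifPn => iI.
  exact: quad_ext'_slope (psi_barrier iI) _ theta0 _ _ uv.
by rewrite subrr lexx mulr_ge0 ?subr_ge0 // ltW.
Qed.

Lemma smooth'_mono i : {homo smooth' theta i : u v / u <= v}.
Proof. by move=> u v /smooth'_slope - /(_ i) /andP[]; rewrite subr_ge0. Qed.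

Lemma smooth'_lipschitz i u v :
  `|smooth' theta i u - smooth' theta i v| <= theta * `|u - v|.
Proof.
wlog uv : u v / u <= v => [hw|].
  have [|/ltW] := leP u v; first exact: hw.
  by move=> /hw; rewrite distrC (distrC u).
have /andP[h0 h1] := smooth'_slope i uv.
by rewrite distrC (distrC u) !ger0_norm // subr_ge0.
Qed.

Lemma smooth_bounded a : exists m, forall i u, a <= u -> m <= smooth theta i u.
Proof.
have hm i : exists m, forall u, a <= u -> m <= smooth theta i u.
  have [iI|iI] := boolP (i \in I).
    have [m hm] := quad_ext_bounded (psi_barrier iI) theta0.
    by exists m => u _; rewrite /smooth iI.
  exists (alpha i * a) => u au.
  by rewrite /smooth (negbTE iI) ler_wpM2l ?(A_alpha hA iI).
have [m {}hm] := choice hm.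
exists (- \sum_i `|m i|) => i u au; apply: le_trans (hm i u au).
rewrite lerNl (bigD1 i) //=.
have : 0 <= \sum_(j | j != i) `|m j| by rewrite sumr_ge0.
have := ler_norm (- m i); rewrite normrN; lra.
Qed.

(** Left of [delta - eps theta] only the branch [psi i] of [psi_ext] applies, and it
    is infinite there because the truncation point lies left of [delta]; right of
    that point the branches assemble into [smooth]. *)
Lemma psi_extE (eps : R -> R) i u : 0 < eps theta ->
  psi_ext I delta alpha eps psi theta i u =
  if delta - eps theta <= u then (smooth theta i u)%:E else +oo%E.
Proof.
move=> e0; rewrite /psi_ext /smooth; case: ifPn => [/and3P[iI -> uw]|].
  rewrite iI /quad_ext /parabola /zeta0 /zeta1 /=.
  change (knot delta (d2 (psi i)) theta) with (upsilon delta (psi i) theta).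
  by rewrite uw; congr (_%:E); field.
have [eu|ue] := leP (delta - eps theta) u; last first.
  by rewrite !andbF psi_left //; lra.
have [iI|iI] := boolP (i \in I) => /=.
  rewrite -leNgt => wu; rewrite /quad_ext ifF; last by apply/negbTE; rewrite -leNgt.
  by rewrite fineK // psi_fin // (lt_le_trans (knot_gt (psi_barrier iI) theta0)).
by case: ltP => // du _; exact: A_linear hA _ _ _ du.
Qed.

End FixedTheta.
End SmoothPieces.

(** * The extension composed with the linear map *)

Lemma sub_bounded_set (R : realType) (n : nat) (A B : set 'rV[R]_n) :
  A `<=` B -> bounded_set B -> bounded_set A.
Proof. by move=> AB [M [Mr hM]]; exists M; split=> // M' MM' x /AB; exact: hM. Qed.

Lemma coercive_sublevel_bounded (R : realType) (n : nat) (f : 'rV[R]_n -> R) a :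
  coercive (EFin \o f) -> bounded_set [set x | f x <= a].
Proof.
move=> /(_ a)[r hr]; exists r; split; first exact: num_real.
move=> M rM x /= fx; apply: le_trans (norm_le_enorm x) (le_trans _ (ltW rM)).
by rewrite leNgt; apply/negP => /hr; rewrite lte_fin ltNge fx.
Qed.

Lemma convex_set_segment_closed (R : realType) (n : nat) (C : set 'rV[R]_n) :
  @convex_set R 'rV[R]_n C -> segment_closed C.
Proof.
move=> cC x y t Cx Cy t0 t1.
have t01 : 0 <= t <= 1 by rewrite !ltW.
have := cC x y (Itv01 (ltW t0) (ltW t1)).
by rewrite !inE => /(_ Cx Cy).
Qed.

Section Extension.
Context {R : realType} {K N : nat} (L : {linear 'rV[R]_K -> 'rV[R]_N}).
Context (I : {set 'I_N}) (delta : R).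
Context (alpha : 'I_N -> R) (psi : 'I_N -> R -> \bar R).
Hypothesis hA : assumptionA I delta alpha psi.
Context (eps : R -> R).
Hypothesis eps_gt0 : forall theta, 0 < theta -> 0 < eps theta.

Definition box theta : set 'rV[R]_K :=
  [set x | forall i, delta - eps theta <= L x 0 i].

Definition smooth_comp theta x : R :=
  \sum_i smooth I delta alpha psi theta i (L x 0 i).

Lemma separable_psi_extE theta : 0 < theta ->
  (fun x => separable (psi_ext I delta alpha eps psi theta) (L x)) =
  extend (box theta) (smooth_comp theta).
Proof.
move=> t0; apply/funext => x; have e0 := eps_gt0 t0.
have [bx|nbx] := pselect (box theta x).
  rewrite extend_in // /separable -sumEFin; apply: eq_bigr => i _.
  by rewrite (psi_extE hA) // bx.
rewrite extend_out //; apply/esum_eqyP => [i _|].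
  by rewrite (psi_extE hA) //; case: ifP.
have /existsNP[i /negP ui] := nbx; exists i; split; rewrite ?mem_index_enum //.
by rewrite (psi_extE hA) // (negbTE ui).
Qed.

Lemma dom_separable_ge u i : dom (separable psi) u -> delta <= u 0 i.
Proof.
rewrite /dom /= /separable => du; rewrite leNgt; apply/negP => ui.
move: du; rewrite (_ : (\sum_(_ < _) _)%E = +oo%E) ?ltxx //.
apply/esum_eqyP => [j _|]; first exact: A_ninfty hA j _.
by exists i; split; rewrite ?mem_index_enum // (psi_left hA).
Qed.

Lemma box_closed theta : closed (box theta).
Proof.
rewrite (_ : box theta = \bigcap_i [set x | - L x 0 i <= - (delta - eps theta)]).
  apply: closed_bigI => i _; apply: lsc_sublevel_closed.
  apply: continuous_lsc => x.
  exact: continuousN (@linear_coord_continuous _ _ _ L i x).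
apply/seteqP; split=> x /= hx i; first by move=> _ /=; rewrite lerN2.
by have := hx i Logic.I; rewrite /= lerN2.
Qed.

Lemma box_segment_closed theta : segment_closed (box theta).
Proof.
move=> x y t bx by_ t0 t1 i; rewrite linearD !linearZ !mxE.
have hx := ler_wpM2l (ltW t0) (bx i).
have hy : (1 - t) * (delta - eps theta) <= (1 - t) * L y 0 i.
  by rewrite ler_wpM2l // subr_ge0 ltW.
lra.
Qed.

Lemma smooth_comp_mono s t x : 0 < s -> s <= t ->
  smooth_comp s x <= smooth_comp t x.
Proof. by move=> s0 st; apply: ler_sum => i _; exact: (smooth_mono hA). Qed.

Lemma smooth_comp_le theta x : 0 < theta ->
  ((smooth_comp theta x)%:E <= separable psi (L x))%E.
Proof.
by move=> t0; rewrite -sumEFin; apply: lee_sum => i _; exact: (smooth_le_psi hA).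
Qed.

Section FixedTheta.
Context (theta : R).
Hypothesis theta0 : 0 < theta.

Let qdq i u := is_derive_smooth hA theta0 i u.

Lemma smooth_comp_continuous : continuous (smooth_comp theta).
Proof.
move=> x; apply: differentiable_continuous.
exact: separable_comp_differentiable qdq x.
Qed.

Lemma smooth_comp_convex x y (t : R) : 0 < t -> t < 1 ->
  smooth_comp theta (t *: x + (1 - t) *: y) <=
  t * smooth_comp theta x + (1 - t) * smooth_comp theta y.
Proof.
move=> t0 t1; rewrite /smooth_comp !mulr_sumr -big_split; apply: ler_sum => i _.
rewrite linearD !linearZ !mxE.
exact: (convex_of_monotone_derive (qdq i) (smooth'_mono hA theta0 i)).
Qed.

Lemma smooth_comp_bounded : exists m, forall x, box theta x ->
  m <= smooth_comp theta x.
Proof.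
have [m hm] := smooth_bounded hA theta0 (delta - eps theta).
exists (\sum_(i < N) m) => x bx; apply: ler_sum => i _; exact: hm.
Qed.

(** The strict inequalities define an open set on which the truncation is
    inactive, hence the gradient is that of the smooth composition. *)
Lemma smooth_comp_lipschitz_gradient (C : set 'rV[R]_K) :
  (forall x, C x -> forall i, delta - eps theta < L x 0 i) ->
  lipschitz_gradient_over (extend (box theta) (smooth_comp theta)) C
    (theta * opnorm L ^+ 2).
Proof.
move=> hC; pose U := [set x | forall i, delta - eps theta < L x 0 i].
have oU : open U.
  rewrite openE => x Ux.
  apply: (@filter_forall _ _ (fun i y => delta - eps theta < L y 0 i) (nbhs x)) => i.
  exact: (@linear_coord_continuous _ _ _ L i x _ (lt_nbhsr (Ux i))).
have Ubox x : U x -> box theta x by move=> Ux i; exact: ltW.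
have nearE x : U x ->
    {near x, smooth_comp theta =1 fine \o extend (box theta) (smooth_comp theta)}.
  move=> Ux; have := open_nbhs_nbhs (conj oU Ux); apply: filterS => y Uy.
  by rewrite /= extend_in //; exact: Ubox.
exists U; split=> //.
- by move=> x Ux; rewrite extend_in //; exact: Ubox.
- move=> x Ux; apply: near_eq_differentiable (nearE x Ux) _.
  exact: separable_comp_differentiable qdq x.
- move=> x y Ux Uy.
  have gradE z : U z ->
      grad (fine \o extend (box theta) (smooth_comp theta)) z =
      grad (smooth_comp theta) z.
    by move=> Uz; apply/rowP => k; rewrite !mxE; apply/esym/near_eq_derive/nearE.
  rewrite !gradE //.
  apply: (separable_comp_grad_lipschitz L qdq) => [|i u v]; first exact: ltW.
  exact: (smooth'_lipschitz hA theta0 i u v).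
Qed.

End FixedTheta.
End Extension.

(** * Existence, uniqueness and exactness of minimizers *)

Lemma extend_add_indicator (R : realType) (n : nat) (A C : set 'rV[R]_n)
    (f F : 'rV[R]_n -> R) x :
  ((f x)%:E + extend A F x + indicator R C x)%E = extend (A `&` C) (f \+ F) x.
Proof.
rewrite /extend /indicator in_setI.
by case: (x \in A); case: (x \in C) => //=; rewrite adde0.
Qed.

Section Problem.
Context {R : realType} {K N : nat} (L : {linear 'rV[R]_K -> 'rV[R]_N}).
Context (I : {set 'I_N}) (delta : R).
Context (alpha : 'I_N -> R) (psi : 'I_N -> R -> \bar R).
Hypothesis hA : assumptionA I delta alpha psi.
Context (eps : R -> R).
Hypothesis eps_gt0 : forall theta, 0 < theta -> 0 < eps theta.
Context (C : set 'rV[R]_K) (f : 'rV[R]_K -> R).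
Hypotheses (clC : closed C) (segC : segment_closed C) (lscf : lsc f).
Context (x0 : 'rV[R]_K).
Hypotheses (Cx0 : C x0) (dom_x0 : dom (separable psi) (L x0)).

Local Notation feasible theta := (box L delta eps theta `&` C).
Local Notation G := (smooth_comp L I delta alpha psi).
Local Notation approx theta := (extend (feasible theta) (f \+ G theta)).

Lemma box_of_ge theta x : 0 < theta -> (forall i, delta <= L x 0 i) ->
  box L delta eps theta x.
Proof. by move=> t0 dx i; apply: le_trans (dx i); rewrite gerBl ltW ?eps_gt0. Qed.

Lemma feasible_x0 theta : 0 < theta -> feasible theta x0.
Proof.
move=> t0; split => //; apply: box_of_ge => // i.
exact: dom_separable_ge hA _ i dom_x0.
Qed.

(** The smooth part is bounded below on the feasible set, so a sublevel set of the
    sum is contained in a sublevel set of [f]. *)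
Lemma approx_minimizer_exists theta : 0 < theta ->
  coercive (EFin \o f) \/ bounded_set (feasible theta) ->
  exists x, minimizer (approx theta) x.
Proof.
move=> t0 bnd; have Fx0 := feasible_x0 t0.
have [||||x Fx xmin] := @lsc_min_exists _ _ (feasible theta) (f \+ G theta) x0.
- by apply: closedI => //; exact: box_closed.
- apply: lscD => //; apply: continuous_lsc.
  exact (smooth_comp_continuous hA t0).
- exact: Fx0.
- case: bnd => [cf|]; last by apply: sub_bounded_set; exact: subIsetl.
  have [m hm] := smooth_comp_bounded L hA eps t0.
  apply: sub_bounded_set (coercive_sublevel_bounded (f x0 + G theta x0 - m) cf).
  by move=> x [[bx _] /=]; have := hm x bx; lra.
by exists x; apply/minimizer_extendP => //; exists x0.
Qed.

Lemma approx_strictly_convex theta : 0 < theta ->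
  strictly_convex_on (feasible theta) f ->
  strictly_convex_on (feasible theta) (f \+ G theta).
Proof.
move=> t0 sf x y t Fx Fy xy h0 h1 /=.
have := sf x y t Fx Fy xy h0 h1.
have := smooth_comp_convex L hA t0 x y h0 h1.
lra.
Qed.

Lemma approx_minimizer_unique theta x y : 0 < theta ->
  strictly_convex_on (feasible theta) f ->
  minimizer (approx theta) x -> minimizer (approx theta) y -> x = y.
Proof.
move=> t0 sf; apply: minimizer_unique.
- move=> a b t [ba Ca] [bb Cb] h0 h1; split; last exact: segC.
  exact: box_segment_closed.
- exact: approx_strictly_convex.
- by exists x0; exact: feasible_x0.
Qed.

Lemma lsc_bounded_below : coercive (EFin \o f) \/ bounded_set C ->
  exists m, forall x, C x -> m <= f x.
Proof.
move=> bnd; have [||||x Cx xmin] := @lsc_min_exists _ _ C f x0 => //.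
  case: bnd => [cf|].
    by apply: sub_bounded_set (coercive_sublevel_bounded (f x0) cf); exact: subIsetr.
  by apply: sub_bounded_set; exact: subIsetl.
by exists (f x).
Qed.

(** The objective of the approximation at its minimizer is at most the original
    objective at [x0], whatever [theta]. As [f] and all coordinate terms are
    bounded below uniformly in [theta], every single barrier term is bounded by
    a constant, which for large [theta] forces each coordinate past the point up
    to which the parabola replaces the barrier. *)
Lemma approx_exact :
  (forall x, C x -> forall i, delta <= L x 0 i) ->
  coercive (EFin \o f) \/ bounded_set C ->
  exists2 theta_bar, 0 < theta_bar & forall theta x, theta_bar <= theta ->
    minimizer (approx theta) x -> separable psi (L x) = (G theta x)%:E.
Proof.
move=> C_ge bnd.
have [mf hmf] := lsc_bounded_below bnd.
have [m0 hm0] := smooth_bounded hA ltr01 delta.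
(* A nonpositive bound survives when the sum over all indices is compared with
   the sum over all indices but one. *)
pose m := Num.min m0 0.
have m_le0 : m <= 0 by rewrite ge_min lexx orbT.
have hm theta i u : 1 <= theta -> delta <= u ->
    m <= smooth I delta alpha psi theta i u.
  move=> t1 du; apply: le_trans (smooth_mono hA i u ltr01 t1).
  by apply: le_trans (hm0 i u du); rewrite ge_min lexx.
have [r0 hr0] : exists r0, separable psi (L x0) = r0%:E.
  exists (fine (separable psi (L x0))); rewrite fineK // fin_numE.
  rewrite -ltey dom_x0 andbT; apply/eqP => h.
  by have := smooth_comp_le L hA x0 ltr01; rewrite h.
pose B := f x0 + r0 - mf - \sum_(i < N) m.
have [t1 t1_gt0 ht1] := smooth_sublevel hA B.
exists (Num.max 1 t1) => [|theta x]; first by rewrite lt_max ltr01.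
rewrite ge_max => /andP[th1 tht1] xmin; have t0 := lt_le_trans ltr01 th1.
have [[bx Cx] xmin'] := (minimizer_extendP x (ex_intro _ x0 (feasible_x0 t0))).1 xmin.
rewrite /separable -sumEFin; apply: eq_bigr => i _.
apply: (smooth_eq_psi hA) => // [|iI]; first exact: C_ge.
apply: (ht1 theta i _ tht1 iI).
have Gx0 : G theta x0 <= r0.
  by rewrite -lee_fin -hr0; exact: smooth_comp_le.
have rest : \sum_(j < N) m <=
    \sum_(j < N | j != i) smooth I delta alpha psi theta j (L x 0 j).
  rewrite [leLHS](bigD1 i) //=; apply: le_trans (_ : \sum_(j < N | j != i) m <= _).
    by rewrite gerDr.
  by apply: ler_sum => j _; apply: hm => //; exact: C_ge.
have := xmin' x0 (feasible_x0 t0); have := hmf x Cx.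
have Gx : G theta x = smooth I delta alpha psi theta i (L x 0 i) +
    \sum_(j < N | j != i) smooth I delta alpha psi theta j (L x 0 j).
  by rewrite /smooth_comp (bigD1 i).
by rewrite /= Gx /B; lra.
Qed.

End Problem.

Theorem proposition5p4 (R : realType) (K N : nat) (hKN : (N <= K)%N)
    (T : {linear 'rV[R]_N -> 'rV[R]_N}) (Fs : {linear 'rV[R]_K -> 'rV[R]_N})
    (nu_lo nu_hi : R) (hF : frame_synthesis Fs nu_lo nu_hi)
    (C : set 'rV[R]_K) (hCclosed : closed C)
    (hCconvex : @convex_set R 'rV[R]_K C)
    (I : {set 'I_N}) (delta : R) (alpha : 'I_N -> R)
    (psi : 'I_N -> R -> \bar R) (hA : assumptionA I delta alpha psi)
    (phi : 'I_K -> R -> R)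
    (hphi : forall k, @Gamma0 R R (fun t => (phi k t)%:E))
    (eps : R -> R) (heps_gt0 : forall theta, 0 < theta -> 0 < eps theta)
    (heps_decr : decreasing_on_ray 0 eps)
    (hdom : (T @` (Fs @` C)) `&` dom (separable psi) !=set0) :
  let f : 'rV[R]_K -> R := fun x => \sum_(k < K) phi k (x 0 k) in
  let g : 'rV[R]_K -> \bar R := fun x => separable psi (T (Fs x)) in
  let g_ (theta : R) : 'rV[R]_K -> \bar R := fun x =>
    separable (psi_ext I delta alpha eps psi theta) (T (Fs x)) in
  let obj (h : 'rV[R]_K -> \bar R) : 'rV[R]_K -> \bar R := fun x =>
    ((f x)%:E + h x + indicator R C x)%E in
  (forall theta, 0 < theta -> Gamma0 (g_ theta)) /\
  (forall theta1 theta2, 0 < theta1 -> 0 < theta2 -> theta1 < theta2 ->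
    forall x, (g_ theta1 x <= g_ theta2 x)%E /\ (g_ theta2 x <= g x)%E) /\
  (forall theta, 0 < theta ->
    T @` (Fs @` C) `<=` [set u : 'rV[R]_N | forall i, delta - eps theta < u 0 i] ->
    lipschitz_gradient_over (g_ theta) C (theta * opnorm (T \o Fs) ^+ 2) /\
    theta * opnorm (T \o Fs) ^+ 2 <= theta * nu_hi * opnorm T ^+ 2) /\
  (forall theta, 0 < theta ->
    coercive (EFin \o f) \/ bounded_set (dom (g_ theta) `&` C) ->
    (exists x, minimizer (obj (g_ theta)) x) /\
    (strictly_convex_on (dom (g_ theta) `&` C) f ->
      exists! x, minimizer (obj (g_ theta)) x)) /\
  (eps theta @[theta --> +oo] --> (0 : R) ->
    T @` (Fs @` C) `<=` [set u : 'rV[R]_N | forall i, delta <= u 0 i] ->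
    coercive (EFin \o f) \/ bounded_set C ->
    strictly_convex_on C f ->
    exists2 theta_bar, 0 < theta_bar &
      forall theta, theta_bar <= theta ->
        exists x, unique (minimizer (obj (g_ theta))) x /\
                  unique (minimizer (obj g)) x).
Proof.
  (* your proof *)
Proof.
move=> f g g_ obj; pose L : {linear 'rV[R]_K -> 'rV[R]_N} := T \o Fs.
have [_ [[_ [x0 Cx0 <-] <-] dom_x0]] := hdom.
have {dom_x0} domx0 : dom (separable psi) (L x0) by [].
have segC := convex_set_segment_closed hCconvex.
have lscf : lsc f.
  apply: lsc_sum => k.
  apply: (@lsc_comp _ _ _ (fun x : 'rV[R]_K => x 0 k)).
    by move=> x; exact: coord_continuous.
  by have [] := hphi k.
have gE theta : 0 < theta -> g_ theta =
    extend (box L delta eps theta) (smooth_comp L I delta alpha psi theta).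
  by move=> t0; exact: (separable_psi_extE L hA heps_gt0 t0).
have dom_g theta : 0 < theta -> dom (g_ theta) = box L delta eps theta.
  by move=> t0; rewrite gE // dom_extend.
have objE theta : 0 < theta -> obj (g_ theta) =
    extend (box L delta eps theta `&` C) (f \+ smooth_comp L I delta alpha psi theta).
  by move=> t0; apply/funext => x; rewrite /obj gE // extend_add_indicator.
have i_mono : forall theta1 theta2, 0 < theta1 -> theta1 <= theta2 ->
    forall x, (g_ theta1 x <= g_ theta2 x)%E.
  move=> s t s0 st x; have t0 := lt_le_trans s0 st; rewrite !gE //.
  have [bx|nbx] := pselect (box L delta eps t x); last first.
    by rewrite [leRHS]extend_out // leey.
  rewrite !extend_in ?lee_fin //; first exact: (smooth_comp_mono L hA).
  by move=> i; apply: le_trans (bx i); rewrite lerB // heps_decr.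
have le_g theta x : 0 < theta -> (g_ theta x <= g x)%E.
  move=> t0; rewrite gE //.
  have [bx|nbx] := pselect (box L delta eps theta x).
    by rewrite extend_in //; exact: (smooth_comp_le L hA).
  rewrite [leRHS](_ : g x = +oo%E) ?leey //; apply/eqP; rewrite -leye_eq leNgt.
  apply/negP => gx; apply: nbx; apply: (box_of_ge heps_gt0) => // i.
  exact: (dom_separable_ge hA i gx).
have iv theta : 0 < theta ->
    coercive (EFin \o f) \/ bounded_set (dom (g_ theta) `&` C) ->
    (exists x, minimizer (obj (g_ theta)) x) /\
    (strictly_convex_on (dom (g_ theta) `&` C) f ->
      exists! x, minimizer (obj (g_ theta)) x).
  move=> t0; rewrite objE // dom_g // => bnd.
  have [x xmin] := approx_minimizer_exists hA heps_gt0 hCclosed lscf Cx0 domx0 t0 bnd.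
  split; first by exists x.
  move=> sf; exists x; split=> // y ymin.
  exact: (approx_minimizer_unique hA heps_gt0 segC Cx0 domx0 t0 sf xmin ymin).
split; [|split; [|split; [|split => //]]].
- move=> theta t0; rewrite gE //; apply: Gamma0_extend.
  + exact: box_closed.
  + exact: box_segment_closed.
  + by exists x0; have [] := feasible_x0 hA heps_gt0 Cx0 domx0 t0.
  + exact (smooth_comp_continuous hA t0).
  + move=> x y t; exact: (smooth_comp_convex L hA t0).
- by move=> s t s0 t0 st x; split; [exact: i_mono (ltW st) _|exact: le_g].
- move=> theta t0 TC; split; last first.
    rewrite -mulrA; apply: ler_wpM2l; [exact: ltW|exact (opnorm_frame T hF)].
  rewrite gE //; apply: (smooth_comp_lipschitz_gradient (L := L) hA t0) => x Cx i.
  by apply: TC; exists (Fs x) => //; exists x.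
- move=> _ TC bnd sf.
  have C_ge x : C x -> forall i, delta <= L x 0 i.
    by move=> Cx i; apply: TC; exists (Fs x) => //; exists x.
  have [tb tb0 exact] := approx_exact hA heps_gt0 hCclosed lscf Cx0 domx0 C_ge bnd.
  exists tb => // theta tbt; have t0 := lt_le_trans tb0 tbt.
  have bnd' : coercive (EFin \o f) \/ bounded_set (dom (g_ theta) `&` C).
    case: bnd => [cf|bC]; [by left|right].
    exact: sub_bounded_set (@subIsetr _ _ _) bC.
  have sf' : strictly_convex_on (dom (g_ theta) `&` C) f.
    by move=> a b t [_ Ca] [_ Cb]; exact: sf.
  have [_ /(_ sf') [x [xmin xuniq]]] := iv theta t0 bnd'.
  have gx : g x = g_ theta x.
    have xmin' := xmin; rewrite objE // in xmin'.
    rewrite [LHS](exact theta x tbt xmin') gE // extend_in //.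
    have A0 : (box L delta eps theta `&` C) !=set0.
      by exists x0; exact: (feasible_x0 hA heps_gt0 Cx0 domx0 t0).
    by have [[]] := (minimizer_extendP x A0).1 xmin'.
  (* The approximation is a minorant that touches the objective at [x], so its
     minimizers and those of the objective coincide. *)
  have obj_le y : (obj (g_ theta) y <= obj g y)%E.
    by rewrite /obj leeD2r // leeD2l // le_g.
  have obj_x : obj g x = obj (g_ theta) x by rewrite /obj gx.
  exists x; split; first by split.
  split=> [y|y ymin]; first by rewrite obj_x; exact: le_trans (xmin y) (obj_le y).
  apply: xuniq => z; apply: le_trans (obj_le y) _.
  by apply: le_trans (ymin x) _; rewrite obj_x; exact: xmin.
Qed.
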